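(* Let $K$ be a positive real number and let $f=h+\overline{g}$ be a normal harmonic mapping in $\mathbb{D}$. Then for each positive integer $n$ there exists a constant $E_n(f,K)$ such that $$(1-|z|^2)^n\bigl(|h^{(n)}(z)|+|g^{(n)}(z)|\bigr)\le E_n(f,K)$$ for each $z\in\mathbb{D}$ with $|f(z)|\le K$.
   Context: $\mathbb{D}=\{z\in\mathbb{C}:|z|<1\}$. A harmonic mapping in $\mathbb{D}$ is a complex-valued harmonic function $f$; it has the canonical decomposition $f=h+\overline{g}$ with $h,g$ analytic in $\mathbb{D}$ (unique up to additive constants). Put $$f^{\#}(z)=\frac{|h'(z)|+|g'(z)|}{1+|f(z)|^2}.$$ A harmonic mapping $f$ in $\mathbb{D}$ is called normal if $\sup_{z\in\mathbb{D}}(1-|z|^2)f^{\#}(z)<\infty$. *)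

(* Defs.v *)
(* Stdlib real numbers with Coquelicot. *)
From Stdlib Require Import Reals.
From Coquelicot Require Import Coquelicot.

Open Scope R_scope.

(* Functions on the unit disc are total functions C -> C whose values outside
   the disc are irrelevant. *)
Definition unit_disc (z : C) : Prop := Cmod z < 1.

(* Analyticity is complex differentiability at each point of the (open) disc:
   the scalars of ex_derive are C_AbsRing here. *)
Definition analytic_in_disc (h : C -> C) : Prop :=
  forall z : C, unit_disc z -> @ex_derive C_AbsRing C_NormedModule h z.

(* The n-th complex derivative h^(n); it is total, and it is the true
   derivative when h is analytic (see C_derive_correct). *)
Fixpoint C_derive_n (h : C -> C) (n : nat) : C -> C :=
  match n with
  | O => h
  | S m => C_derive (C_derive_n h m)
  end.

(* ex_diff_n u 2 at every point of the disc says that u is of class C^2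
   there. *)
Definition harmonic_in_disc (u : R -> R -> R) : Prop :=
  forall x y : R, unit_disc (x, y) ->
    ex_diff_n u 2 x y /\
    partial_derive 2 0 u x y + partial_derive 0 2 u x y = 0.

Definition harmonic_mapping (f : C -> C) : Prop :=
  harmonic_in_disc (fun x y => Re (f (x, y))) /\
  harmonic_in_disc (fun x y => Im (f (x, y))).

Definition canonical_decomposition (f h g : C -> C) : Prop :=
  analytic_in_disc h /\ analytic_in_disc g /\
  forall z : C, unit_disc z -> f z = Cplus (h z) (Cconj (g z)).

(* f^#, computed from a canonical decomposition f = h + conj g. *)
Definition sharp (f h g : C -> C) (z : C) : R :=
  (Cmod (C_derive h z) + Cmod (C_derive g z)) / (1 + Cmod (f z) ^ 2).

(* h and g are determined by f up to additive constants, so f^# does not depend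
   on the decomposition chosen. *)
Definition normal_harmonic_mapping (f : C -> C) : Prop :=
  harmonic_mapping f /\
  exists h g : C -> C,
    canonical_decomposition f h g /\
    exists M : R, forall z : C, unit_disc z ->
      (1 - Cmod z ^ 2) * sharp f h g z <= M.

(* Main.v *)
(** Near a point [z] with [|f z| <= K], normality says that [|f|] grows at
    rate at most [2 M (1 + |f|^2) / d] with [d = 1 - |z|]; as
    [1 / sqrt (1 + |f|^2)] is then Lipschitz, [|f|] stays bounded on a disc of
    radius [c d], where [c] depends only on [K] and [M]. There [|h'| + |g'|] is
    at most a constant over [d], and Cauchy's estimates for [h'] and [g'] on
    this disc give the bound for the higher derivatives.

    Cauchy's estimate is needed for complex differentiable functions only.
    As [f] is of class [C^2], its Wirtinger derivatives [h'] and [conj g'] are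
    continuous, so Goursat's theorem is not needed. For [F'] continuous, the
    integral [phi s] over [0 <= t <= 2 pi] of
    [Re (F (c + s e^(it)) e^(-it))] satisfies [s phi' = phi] and
    [phi' 0 = 2 pi Re (F' c)], hence [phi r = 2 pi r Re (F' c)], which gives
    [|F' c| <= sup |F| / r]. Applied to [F (z + k) - F z] and to differences of
    two difference quotients of [F], this estimate alone shows that [F'] is
    again differentiable with continuous derivative. *)

Require Import Defs.
From Stdlib Require Import Reals Lra Lia Psatz.
From Coquelicot Require Import Coquelicot.

(** * Complex differentiability *)

Local Notation C_is_derive := (@is_derive C_AbsRing C_NormedModule).
Local Notation C_ex_derive := (@ex_derive C_AbsRing C_NormedModule).
Local Notation C_continuous := (@continuous C_UniformSpace C_UniformSpace).

(** Substituting [y = z + k] turns the filter definition into an estimate on increments, so that the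
    later arguments deal with moduli only. *)
Lemma C_is_derive_eps (F : C -> C) (z l : C) :
  C_is_derive F z l <->
  forall eps : posreal, exists delta : posreal, forall k : C, Cmod k < delta ->
    Cmod (F (z + k) - F z - k * l)%C <= eps * Cmod k.
Proof.
split.
- intros [_ H] eps.
  destruct (H z (fun P HP => HP) eps) as [d Hd].
  exists d; intros k Hk.
  assert (E : ((z + k) - z)%C = k) by ring.
  generalize (Hd (z + k)%C).
  change (minus (z + k)%C z) with ((z + k) - z)%C.
  rewrite E; intros Hd'.
  apply Hd'.
  change (Cmod ((z + k) - z)%C < d); now rewrite E.
- intros H; split; [ apply is_linear_scal_l | ].
  intros x Hx eps.
  assert (Ex : x = z) by (symmetry; now apply is_filter_lim_locally_unique).
  subst x.
  destruct (H eps) as [d Hd].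
  exists d; intros y Hy.
  change (Cmod (y - z)%C < d) in Hy.
  generalize (Hd _ Hy).
  assert (E : (z + ((y : C) - z))%C = y) by (change (z + (y - z) = y :> C)%C; ring).
  rewrite E; intros Hyy; exact Hyy.
Qed.

Lemma im_le_Cmod (z : C) : Rabs (snd z) <= Cmod z.
Proof. apply Rle_trans with (2 := Rmax_Cmod z), Rmax_r. Qed.

Lemma Cmod_le_abs (z : C) : Cmod z <= Rabs (fst z) + Rabs (snd z).
Proof.
pose proof (Rabs_pos (fst z)); pose proof (Rabs_pos (snd z)).
unfold Cmod; apply Rsqr_incr_0_var; [ | lra ].
rewrite Rsqr_sqrt by nra.
rewrite <- (pow2_abs (fst z)), <- (pow2_abs (snd z)); unfold Rsqr; nra.
Qed.

(* The Cauchy-Riemann equations. *)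
Lemma C_derive_differentiable (F : C -> C) (z l : C) :
  C_is_derive F z l ->
  differentiable_pt_lim (fun x y => fst (F (x, y))) (fst z) (snd z)
    (fst l) (- snd l) /\
  differentiable_pt_lim (fun x y => snd (F (x, y))) (fst z) (snd z)
    (snd l) (fst l).
Proof.
intros H0; assert (H := proj1 (C_is_derive_eps F z l) H0); clear H0.
(* [differentiable_pt_lim] measures an increment by its larger coordinate, and [Cmod k] is at most
   twice that; hence the [eps / 2]. *)
assert (K : forall eps : posreal, locally_2d (fun u v =>
   Cmod (F (u, v) - F z - ((u, v) - z) * l)%C
     <= eps * Rmax (Rabs (u - fst z)) (Rabs (v - snd z))) (fst z) (snd z)).
{ intros eps.
  assert (He : 0 < eps / 2) by (destruct eps; simpl; lra).
  destruct (H (mkposreal _ He)) as [d Hd]; simpl in Hd.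
  assert (Hd2 : 0 < d / 2) by (destruct d; simpl; lra).
  exists (mkposreal _ Hd2); simpl; intros u v Hu Hv.
  set (k := (u - fst z, v - snd z) : C).
  assert (Hk : Cmod k <= 2 * Rmax (Rabs (u - fst z)) (Rabs (v - snd z))).
  { apply Rle_trans with (1 := Cmod_le_abs k); unfold k; simpl.
    pose proof (Rmax_l (Rabs (u - fst z)) (Rabs (v - snd z))).
    pose proof (Rmax_r (Rabs (u - fst z)) (Rabs (v - snd z))). lra. }
  assert (Hk' : Cmod k < d).
  { apply Rle_lt_trans with (1 := Cmod_le_abs k); unfold k; simpl; lra. }
  specialize (Hd k Hk').
  replace (z + k)%C with ((u, v) : C) in Hd
    by (unfold k; destruct z; apply injective_projections; simpl; ring).
  replace k with ((u, v) - z)%C in Hd at 1 by reflexivity.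
  apply Rle_trans with (1 := Hd).
  apply Rle_trans with (eps / 2 * (2 * Rmax (Rabs (u - fst z)) (Rabs (v - snd z)))).
  apply Rmult_le_compat_l; [ lra | exact Hk ].
  right; field. }
split; intros eps; destruct (K eps) as [d Hd]; exists d; intros u v Hu Hv;
  assert (Huv := Hd u v Hu Hv); apply Rle_trans with (2 := Huv).
- apply Rle_trans with (2 := re_le_Cmod _); right; f_equal.
  destruct z; simpl; ring.
- apply Rle_trans with (2 := im_le_Cmod _); right; f_equal.
  destruct z; simpl; ring.
Qed.

(** The chain rule: both values are the coordinates of [l * (dp, dq)]. The curves will be segments
    in the mean value inequality, rays and circles in Cauchy's estimate. *)
Lemma is_derive_C_curve (F : C -> C) (p q : R -> R) (t dp dq : R) (l : C) :
  C_is_derive F (p t, q t) l ->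
  is_derive p t dp -> is_derive q t dq ->
  is_derive (fun s => fst (F (p s, q s))) t (fst l * dp - snd l * dq) /\
  is_derive (fun s => snd (F (p s, q s))) t (snd l * dp + fst l * dq).
Proof.
intros HF Hp Hq.
apply is_derive_Reals in Hp; apply is_derive_Reals in Hq.
destruct (C_derive_differentiable _ _ _ HF) as [H1 H2]; simpl in H1, H2.
split; apply is_derive_Reals.
- replace (fst l * dp - snd l * dq) with (fst l * dp + (- snd l) * dq) by ring.
  apply (derivable_pt_lim_comp_2d (fun x y => fst (F (x, y)))); assumption.
- apply (derivable_pt_lim_comp_2d (fun x y => snd (F (x, y)))); assumption.
Qed.

Lemma C_is_derive_minus (F G : C -> C) (z l m : C) :
  C_is_derive F z l -> C_is_derive G z m ->
  C_is_derive (fun w => F w - G w)%C z (l - m)%C.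
Proof. exact (is_derive_minus F G z l m). Qed.

Lemma C_is_derive_scal (F : C -> C) (a z l : C) :
  C_is_derive F z l -> C_is_derive (fun w => a * F w)%C z (a * l)%C.
Proof.
intros H; apply C_is_derive_eps; intros eps.
assert (Ha := Cmod_ge_0 a).
assert (He : 0 < eps / (1 + Cmod a)).
{ apply Rdiv_lt_0_compat; [ apply cond_pos | lra ]. }
destruct (proj1 (C_is_derive_eps F z l) H (mkposreal _ He)) as [d Hd]; simpl in Hd.
exists d; intros k Hk; specialize (Hd k Hk).
replace (a * F (z + k) - a * F z - k * (a * l))%C
  with (a * (F (z + k) - F z - k * l))%C by ring.
rewrite Cmod_mult.
apply Rle_trans with (Cmod a * (eps / (1 + Cmod a) * Cmod k)).
now apply Rmult_le_compat_l.
replace (Cmod a * (eps / (1 + Cmod a) * Cmod k))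
  with (eps * Cmod k * (Cmod a / (1 + Cmod a))) by (field; lra).
rewrite <- (Rmult_1_r (eps * Cmod k)) at 2.
apply Rmult_le_compat_l.
apply Rmult_le_pos; [ left; apply cond_pos | apply Cmod_ge_0 ].
apply Rmult_le_reg_r with (1 + Cmod a); [ lra | ].
unfold Rdiv; rewrite Rmult_assoc, Rinv_l by lra; lra.
Qed.

Lemma C_is_derive_id (z : C) : C_is_derive (fun w => w) z (RtoC 1).
Proof.
apply C_is_derive_eps; intros eps; exists (mkposreal _ Rlt_0_1); intros k _.
replace (z + k - z - k * RtoC 1)%C with (RtoC 0) by ring.
rewrite Cmod_0; apply Rmult_le_pos; [ left; apply cond_pos | apply Cmod_ge_0 ].
Qed.

Lemma C_is_derive_shift (F : C -> C) (a z l : C) :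
  C_is_derive F (z + a)%C l -> C_is_derive (fun w => F (w + a)%C) z l.
Proof.
intros H; apply C_is_derive_eps; intros eps.
destruct (proj1 (C_is_derive_eps F _ l) H eps) as [d Hd].
exists d; intros k Hk; specialize (Hd k Hk).
now replace (z + k + a)%C with (z + a + k)%C by ring.
Qed.

(** The balls of [C_UniformSpace] are coordinate squares, unlike the discs of [C_is_derive_eps]; the
    proof compares the two. *)
Lemma C_continuous_eps (F : C -> C) (z : C) :
  C_continuous F z <->
  forall eps : posreal, exists delta : posreal, forall k : C, Cmod k < delta ->
    Cmod (F (z + k) - F z)%C <= eps.
Proof.
split.
- intros H eps.
  assert (He : 0 < eps / 2) by (destruct eps; simpl; lra).
  destruct (proj1 (filterlim_locally F (F z)) H (mkposreal _ He)) as [d Hd].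
  exists d; intros k Hk.
  assert (B : ball z d (z + k)%C).
  { apply C_NormedModule_mixin_compat1.
    change (Cmod ((z + k) - z)%C < d).
    now replace (z + k - z)%C with k by ring. }
  destruct (Hd _ B) as [B1 B2].
  apply Rle_trans with (1 := Cmod_le_abs _).
  change (Rabs (fst (F (z + k)%C) - fst (F z)) < eps / 2) in B1.
  change (Rabs (snd (F (z + k)%C) - snd (F z)) < eps / 2) in B2.
  unfold Rminus in B1, B2; simpl; lra.
- intros H; apply filterlim_locally; intros eps.
  assert (He : 0 < eps / 2) by (destruct eps; simpl; lra).
  destruct (H (mkposreal _ He)) as [d Hd]; simpl in Hd.
  assert (Hd2 : 0 < d / 2) by (destruct d; simpl; lra).
  exists (mkposreal _ Hd2); intros y [Y1 Y2].
  change (Rabs (fst y - fst z) < d / 2) in Y1.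
  change (Rabs (snd y - snd z) < d / 2) in Y2.
  apply C_NormedModule_mixin_compat1.
  change (Cmod (F y - F z)%C < eps).
  replace y with (z + (y - z))%C by ring.
  apply Rle_lt_trans with (eps / 2); [ | destruct eps; simpl; lra ].
  apply Hd, Rle_lt_trans with (1 := Cmod_le_abs _).
  unfold Rminus in Y1, Y2; simpl; lra.
Qed.

Lemma C_is_derive_continuous (F : C -> C) (z l : C) :
  C_is_derive F z l -> C_continuous F z.
Proof.
intros H; apply C_continuous_eps; intros eps.
destruct (proj1 (C_is_derive_eps F z l) H (mkposreal _ Rlt_0_1)) as [d Hd]; simpl in Hd.
assert (Hl := Cmod_ge_0 l).
assert (Hm : 0 < Rmin d (eps / (1 + Cmod l))).
{ apply Rmin_pos; [ apply cond_pos | apply Rdiv_lt_0_compat; [ apply cond_pos | lra ] ]. }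
exists (mkposreal _ Hm); simpl; intros k Hk.
assert (K1 := Rlt_le_trans _ _ _ Hk (Rmin_l _ _)).
assert (K2 := Rlt_le_trans _ _ _ Hk (Rmin_r _ _)).
specialize (Hd k K1).
replace (F (z + k) - F z)%C with ((F (z + k) - F z - k * l) + k * l)%C by ring.
apply Rle_trans with (1 := Cmod_triangle _ _).
rewrite Cmod_mult.
apply Rle_trans with (Cmod k * (1 + Cmod l)); [ lra | ].
apply (Rmult_lt_compat_r (1 + Cmod l)), Rlt_le in K2; [ | lra ].
apply Rle_trans with (1 := K2); right; field; lra.
Qed.

Lemma C_continuous_scal (F : C -> C) (a z : C) :
  C_continuous F z -> C_continuous (fun w => a * F w)%C z.
Proof.
intros H; apply C_continuous_eps; intros eps.
assert (Ha := Cmod_ge_0 a).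
assert (He : 0 < eps / (1 + Cmod a)).
{ apply Rdiv_lt_0_compat; [ apply cond_pos | lra ]. }
destruct (proj1 (C_continuous_eps F z) H (mkposreal _ He)) as [d Hd]; simpl in Hd.
exists d; intros k Hk; specialize (Hd k Hk).
replace (a * F (z + k) - a * F z)%C with (a * (F (z + k) - F z))%C by ring.
rewrite Cmod_mult.
apply Rle_trans with ((1 + Cmod a) * (eps / (1 + Cmod a))).
apply Rmult_le_compat; [ lra | apply Cmod_ge_0 | lra | exact Hd ].
right; field; lra.
Qed.

Lemma C_continuous_minus (F G : C -> C) (z : C) :
  C_continuous F z -> C_continuous G z -> C_continuous (fun w => F w - G w)%C z.
Proof. exact (continuous_minus (V := C_NormedModule) F G z). Qed.

Lemma C_continuous_shift (F : C -> C) (a z : C) :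
  C_continuous F (z + a)%C -> C_continuous (fun w => F (w + a)%C) z.
Proof.
intros H; apply C_continuous_eps; intros eps.
destruct (proj1 (C_continuous_eps F _) H eps) as [d Hd].
exists d; intros k Hk; specialize (Hd k Hk).
now replace (z + k + a)%C with (z + a + k)%C by ring.
Qed.

(** With [D] the increment of [F], the real mean value theorem is applied to the real part of
    conj(D) F along the segment. This function grows by |D|^2, its derivative is at most |D| L |k|,
    and one factor |D| cancels unless it vanishes. *)
Lemma C_mean_value (F F' : C -> C) (z k : C) (L : R) :
  (forall t, 0 <= t <= 1 -> C_is_derive F (z + t * k)%C (F' (z + t * k)%C)) ->
  (forall t, 0 <= t <= 1 -> Cmod (F' (z + t * k)%C) <= L) ->
  Cmod (F (z + k) - F z)%C <= L * Cmod k.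
Proof.
intros HF HL.
set (D := (F (z + k) - F z)%C).
destruct (Req_dec (Cmod D) 0) as [D0 | D0].
{ rewrite D0; apply Rmult_le_pos; [ | apply Cmod_ge_0 ].
  apply Rle_trans with (2 := HL 0 ltac:(lra)), Cmod_ge_0. }
assert (Dp : 0 < Cmod D) by (pose proof (Cmod_ge_0 D); lra).
set (phi := fun t => fst (Cconj D * F (fst z + t * fst k, snd z + t * snd k)%R)%C).
set (dphi := fun t => fst (Cconj D * (F' (z + t * k) * k))%C).
assert (Ez : forall t : R, (z + t * k)%C = (fst z + t * fst k, snd z + t * snd k)%R).
{ intros t; destruct z, k; apply injective_projections; simpl; ring. }
assert (Hphi : forall t, 0 <= t <= 1 -> is_derive phi t (dphi t)).
{ intros t Ht.
  generalize (HF t Ht); rewrite Ez; intros HF'.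
  apply (C_is_derive_scal _ (Cconj D)) in HF'.
  destruct (is_derive_C_curve _ (fun s => fst z + s * fst k)
    (fun s => snd z + s * snd k) t (fst k) (snd k) _ HF') as [H _].
  - auto_derive; trivial; ring.
  - auto_derive; trivial; ring.
  - evar (m : R); replace (dphi t) with m; [ exact H | ].
    unfold m, dphi; rewrite Ez; simpl; ring. }
destruct (MVT_gen phi 0 1 dphi) as [c [Hc E]].
{ rewrite Rmin_left, Rmax_right by lra; intros t Ht; apply Hphi; lra. }
{ rewrite Rmin_left, Rmax_right by lra; intros t Ht.
  apply continuity_pt_filterlim.
  apply (ex_derive_continuous phi); eexists; now apply Hphi. }
rewrite Rmin_left, Rmax_right in Hc by lra.
assert (E1 : phi 1 - phi 0 = Cmod D ^ 2).
{ rewrite Cmod2_alt; unfold phi.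
  replace ((fst z + 1 * fst k, snd z + 1 * snd k) : C) with (z + k)%C
    by (destruct z, k; apply injective_projections; simpl; ring).
  replace ((fst z + 0 * fst k, snd z + 0 * snd k) : C) with z
    by (destruct z, k; apply injective_projections; simpl; ring).
  unfold D, Re, Im; destruct (F (z + k)%C), (F z); simpl; ring. }
assert (B : Rabs (dphi c) <= Cmod D * (L * Cmod k)).
{ apply Rle_trans with (1 := re_le_Cmod _).
  rewrite !Cmod_mult, Cmod_conj.
  apply Rmult_le_compat_l; [ lra | ].
  apply Rmult_le_compat_r; [ apply Cmod_ge_0 | now apply HL ]. }
assert (B' := Rle_trans _ _ _ (Rle_abs _) B).
apply Rmult_le_reg_l with (1 := Dp).
replace (Cmod D * Cmod D) with (Cmod D ^ 2) by ring.
lra.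
Qed.

(** * Cauchy's estimate *)

(** Negative radii are allowed, so that circle integrals can be differentiated at radius 0. *)
Definition polar (c : C) (s t : R) : C := (fst c + s * cos t, snd c + s * sin t).

Lemma polar_dist (c : C) (s t : R) : Cmod (polar c s t - c)%C = Rabs s.
Proof.
unfold polar, Cmod; destruct c as [a b]; simpl fst; simpl snd.
rewrite <- sqrt_Rsqr_abs; f_equal.
unfold Rsqr; generalize (sin2_cos2 t); unfold Rsqr; nra.
Qed.

Lemma continuous_polar (c' : C) (p : R * R) :
  @continuous (prod_UniformSpace R_UniformSpace R_UniformSpace) C_UniformSpace
    (fun q => polar c' (fst q) (snd q)) p.
Proof.
apply (continuous_comp_2 (fun q : R * R => fst c' + fst q * cos (snd q))
  (fun q : R * R => snd c' + fst q * sin (snd q)) (fun x y => (x, y))).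
- apply (continuous_plus (fun _ => fst c') (fun q : R * R => fst q * cos (snd q))).
  apply continuous_const.
  apply (continuous_mult (fun q : R * R => fst q) (fun q : R * R => cos (snd q))).
  apply continuous_fst.
  apply (continuous_comp (fun q : R * R => snd q) cos);
    [ apply continuous_snd | apply continuous_cos ].
- apply (continuous_plus (fun _ => snd c') (fun q : R * R => fst q * sin (snd q))).
  apply continuous_const.
  apply (continuous_mult (fun q : R * R => fst q) (fun q : R * R => sin (snd q))).
  apply continuous_fst.
  apply (continuous_comp (fun q : R * R => snd q) sin);
    [ apply continuous_snd | apply continuous_sin ].
- apply continuous_ext with (f := fun x => x); [ now intros [u v] | apply continuous_id ].
Qed.

Lemma continuity_2d_snd (f : R -> R -> R) x y : continuity_2d_pt f x y -> continuous (f x) y.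
Proof.
intros H; apply continuity_pt_filterlim, continuity_pt_locally; intros eps.
destruct (H eps) as [d Hd]; exists d; intros u Hu.
apply Hd; [ rewrite Rminus_eq_0, Rabs_R0; apply cond_pos | exact Hu ].
Qed.

Section Cauchy.

Variables (F F' : C -> C) (c : C) (rho : R).
Hypothesis HF : forall w, Cmod (w - c)%C < rho -> C_is_derive F w (F' w).
Hypothesis HF' : forall w, Cmod (w - c)%C < rho -> C_continuous F' w.

(** At the point c + s e^(it), [P] and [Q] are the real and imaginary parts of F e^(-it), and [dP]
    is the real part of F'. *)
Let P (s t : R) := fst (F (polar c s t)) * cos t + snd (F (polar c s t)) * sin t.
Let dP (s t : R) := fst (F' (polar c s t)).
Let Q (s t : R) := snd (F (polar c s t)) * cos t - fst (F (polar c s t)) * sin t.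

Lemma polar_in s t : Rabs s < rho -> Cmod (polar c s t - c)%C < rho.
Proof. now rewrite polar_dist. Qed.

Lemma is_derive_P s t : Rabs s < rho -> is_derive (fun x => P x t) s (dP s t).
Proof.
intros Hs; generalize (HF _ (polar_in s t Hs)); intros H.
destruct (is_derive_C_curve F (fun x => fst c + x * cos t)
  (fun x => snd c + x * sin t) s (cos t) (sin t) _ H) as [H1 H2].
{ auto_derive; trivial; ring. }
{ auto_derive; trivial; ring. }
unfold P.
evar_last.
apply (is_derive_plus (fun x => fst (F (polar c x t)) * cos t)
  (fun x => snd (F (polar c x t)) * sin t)).
apply (is_derive_mult (fun x => fst (F (polar c x t))) (fun _ => cos t)).
exact H1. apply is_derive_const. exact Rmult_comm.
apply (is_derive_mult (fun x => snd (F (polar c x t))) (fun _ => sin t)).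
exact H2. apply is_derive_const. exact Rmult_comm.
unfold plus, mult, zero, dP; simpl.
generalize (sin2_cos2 t); unfold Rsqr; intros E.
fold (polar c s t).
transitivity (fst (F' (polar c s t)) * (sin t * sin t + cos t * cos t));
 [ ring | rewrite E; ring ].
Qed.

(** The [t]-derivative of F(c + s e^(it)) e^(-it) is i (s F' - F e^(-it)); this is its imaginary
    part. *)
Lemma is_derive_Q s t : Rabs s < rho -> is_derive (Q s) t (s * dP s t - P s t).
Proof.
intros Hs; generalize (HF _ (polar_in s t Hs)); intros H.
destruct (is_derive_C_curve F (fun x => fst c + s * cos x)
  (fun x => snd c + s * sin x) t (- s * sin t) (s * cos t) _ H) as [H1 H2].
{ auto_derive; trivial; ring. }
{ auto_derive; trivial; ring. }
unfold Q.
evar_last.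
apply (is_derive_minus (fun x => snd (F (polar c s x)) * cos x)
  (fun x => fst (F (polar c s x)) * sin x)).
apply (is_derive_mult (fun x => snd (F (polar c s x))) cos).
exact H2. apply is_derive_Reals, derivable_pt_lim_cos. exact Rmult_comm.
apply (is_derive_mult (fun x => fst (F (polar c s x))) sin).
exact H1. apply is_derive_Reals, derivable_pt_lim_sin. exact Rmult_comm.
unfold minus, plus, opp, mult, dP, P; simpl.
fold (polar c s t).
generalize (sin2_cos2 t); unfold Rsqr; intros E.
transitivity (s * (fst (F' (polar c s t)) * (sin t * sin t + cos t * cos t))
 - (fst (F (polar c s t)) * cos t + snd (F (polar c s t)) * sin t));
 [ ring | rewrite E; ring ].
Qed.

Lemma continuity_2d_dP s t : Rabs s < rho -> continuity_2d_pt dP s t.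
Proof.
intros Hs; apply continuity_2d_pt_filterlim.
apply (continuous_comp (fun q : R * R => F' (polar c (fst q) (snd q))) fst (s, t)).
apply (continuous_comp (fun q : R * R => polar c (fst q) (snd q)) F' (s, t)).
apply continuous_polar.
apply HF', polar_in, Hs.
apply continuous_fst.
Qed.

Lemma continuity_2d_P s t : Rabs s < rho -> continuity_2d_pt P s t.
Proof.
intros Hs.
assert (HC : C_continuous F (polar c s t))
  by (eapply C_is_derive_continuous, HF, polar_in, Hs).
assert (HC' := continuous_comp (fun q : R * R => polar c (fst q) (snd q)) F (s, t)
  (continuous_polar c (s, t)) HC).
apply continuity_2d_pt_plus; apply continuity_2d_pt_mult.
- apply continuity_2d_pt_filterlim.
  apply (continuous_comp (fun q : R * R => F (polar c (fst q) (snd q))) fst (s, t)).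
  exact HC'. apply continuous_fst.
- apply continuity_1d_2d_pt_comp; [ apply continuity_cos | apply continuity_2d_pt_id2 ].
- apply continuity_2d_pt_filterlim.
  apply (continuous_comp (fun q : R * R => F (polar c (fst q) (snd q))) snd (s, t)).
  exact HC'. apply continuous_snd.
- apply continuity_1d_2d_pt_comp; [ apply continuity_sin | apply continuity_2d_pt_id2 ].
Qed.

Let phi (s : R) : R := RInt (P s) 0 (2 * PI).

Lemma locally_disc s : Rabs s < rho -> locally s (fun x => Rabs x < rho).
Proof.
intros Hs.
assert (Hd : 0 < rho - Rabs s) by lra.
exists (mkposreal _ Hd); intros x Hx; change (Rabs (x - s) < rho - Rabs s) in Hx.
replace x with (s + (x - s)) by ring.
apply Rle_lt_trans with (1 := Rabs_triang _ _); lra.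
Qed.

Lemma ex_RInt_P s : Rabs s < rho -> ex_RInt (P s) 0 (2 * PI).
Proof.
intros Hs; apply (ex_RInt_continuous (P s)); intros t _.
now apply continuity_2d_snd, continuity_2d_P.
Qed.

(** Differentiation under the integral sign, which rests on the continuity of [F']. *)
Lemma is_derive_phi s : Rabs s < rho ->
  is_derive phi s (RInt (dP s) 0 (2 * PI)).
Proof.
intros Hs.
replace (RInt (dP s) 0 (2 * PI))
  with (RInt (fun t => Derive (fun x => P x t) s) 0 (2 * PI)).
2: { apply RInt_ext; intros t _; now apply is_derive_unique, is_derive_P. }
apply (is_derive_RInt_param P).
- generalize (locally_disc s Hs); apply filter_imp; intros x Hx t _.
  exists (dP x t); now apply is_derive_P.
- intros t _; apply continuity_2d_pt_ext_loc with dP; [ | now apply continuity_2d_dP ].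
  destruct (locally_disc s Hs) as [d Hd]; exists d; intros u v Hu _.
  symmetry; apply is_derive_unique, is_derive_P, Hd, Hu.
- generalize (locally_disc s Hs); apply filter_imp; intros x Hx.
  now apply ex_RInt_P.
Qed.

(* [s phi' - phi] is the integral over a period of the [t]-derivative of [Q s]. *)
Lemma phi_euler s : Rabs s < rho -> s * RInt (dP s) 0 (2 * PI) = phi s.
Proof.
intros Hs.
assert (CdP : forall t, continuous (dP s) t)
  by (intros t; now apply continuity_2d_snd, continuity_2d_dP).
assert (CP : forall t, continuous (P s) t)
  by (intros t; now apply continuity_2d_snd, continuity_2d_P).
assert (E1 : is_RInt (dP s) 0 (2 * PI) (RInt (dP s) 0 (2 * PI))).
{ apply (RInt_correct (dP s)), (ex_RInt_continuous (dP s)); intros; apply CdP. }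
assert (E2 : is_RInt (P s) 0 (2 * PI) (phi s)).
{ apply (RInt_correct (P s)), ex_RInt_P, Hs. }
assert (E3 := is_RInt_minus _ _ _ _ _ _ (is_RInt_scal _ _ _ s _ E1) E2).
assert (E4 : is_RInt (fun t => s * dP s t - P s t) 0 (2 * PI)
   (minus (Q s (2 * PI)) (Q s 0))).
{ apply (is_RInt_derive (Q s)); intros t _.
  now apply is_derive_Q.
  apply (continuous_minus (fun t => s * dP s t) (P s)); [ | apply CP ].
  apply (continuous_scal_r s (dP s)), CdP. }
assert (E5 : s * RInt (dP s) 0 (2 * PI) - phi s = Q s (2 * PI) - Q s 0).
{ transitivity (RInt (fun t => s * dP s t - P s t) 0 (2 * PI)).
  symmetry; apply is_RInt_unique; exact E3.
  apply is_RInt_unique; exact E4. }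
unfold Q, polar in E5.
rewrite cos_2PI, sin_2PI, cos_0, sin_0 in E5; lra.
Qed.

(** By [phi_euler] the derivative (s phi' - phi) / s^2 of phi / s vanishes. *)
Lemma phi_linear r s : 0 < s <= r -> r < rho -> phi s / s = phi r / r.
Proof.
intros Hs Hr.
destruct (MVT_gen (fun x => phi x / x) s r (fun _ => 0)) as [x [_ E]].
- intros x; rewrite Rmin_left, Rmax_right by lra; intros Hx.
  assert (Hx' : Rabs x < rho) by (rewrite Rabs_pos_eq; lra).
  assert (D := is_derive_phi x Hx').
  assert (E := phi_euler x Hx').
  evar_last.
  apply (is_derive_div phi (fun x => x) x); [ exact D | apply (is_derive_id x) | lra ].
  unfold minus, plus, opp, scal, one; simpl; unfold mult; simpl.
  match goal with |- ?a = ?b => change (a = b :> R) end.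
  rewrite <- E; field; lra.
- intros x; rewrite Rmin_left, Rmax_right by lra; intros Hx.
  assert (Hx' : Rabs x < rho) by (rewrite Rabs_pos_eq; lra).
  apply continuity_pt_filterlim, (ex_derive_continuous (fun x => phi x / x)).
  eexists.
  apply (is_derive_div phi (fun x => x) x);
    [ now apply is_derive_phi | apply (is_derive_id x) | lra ].
- lra.
Qed.

(** The constant value of phi / s is its limit at 0, namely phi'(0), because phi(0) = 0. At radius 0
    the integrand [dP] is the constant Re F'(c). *)
Lemma cauchy_formula_re r : 0 < r < rho -> phi r = r * (2 * PI * fst (F' c)).
Proof.
intros Hr.
assert (H0 : Rabs 0 < rho) by (rewrite Rabs_R0; lra).
assert (D := is_derive_phi 0 H0).
assert (E0 : phi 0 = 0) by (rewrite <- (phi_euler 0 H0); apply Rmult_0_l).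
assert (E1 : RInt (dP 0) 0 (2 * PI) = 2 * PI * fst (F' c)).
{ rewrite (RInt_ext _ (fun _ => fst (F' c))).
  rewrite RInt_const, Rminus_0_r; reflexivity.
  intros t _; unfold dP; do 2 f_equal; unfold polar; destruct c; simpl; f_equal; ring. }
rewrite E1 in D; apply is_derive_Reals in D.
assert (L : phi r / r = 2 * PI * fst (F' c)).
{ apply cond_eq; intros eps He.
  destruct (D eps He) as [d Hd].
  (* Small enough for the difference quotient at 0, and at most [r] so that [phi_linear] compares
     [h] with [r]. *)
  set (h := Rmin (d / 2) r).
  assert (Hh : 0 < h <= r) by
    (split; [ apply Rmin_pos; [ destruct d; simpl; lra | lra ] | apply Rmin_r ]).
  assert (Hh' : h <= d / 2) by apply Rmin_l.
  rewrite <- (phi_linear r h) by lra.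
  specialize (Hd h ltac:(lra)).
  rewrite Rplus_0_l, E0, Rminus_0_r in Hd; apply Hd.
  rewrite Rabs_pos_eq; destruct d; simpl in *; lra. }
rewrite <- L; change (phi r = r * (phi r / r) :> R); field; lra.
Qed.

Lemma cauchy_estimate_re B r : 0 < r < rho ->
  (forall w, Cmod (w - c)%C < rho -> Cmod (F w) <= B) -> fst (F' c) <= B / r.
Proof.
intros Hr HB.
assert (Hr' : Rabs r < rho) by (rewrite Rabs_pos_eq; lra).
assert (PI0 := PI_RGT_0).
assert (E := cauchy_formula_re r Hr).
assert (Ab : Rabs (phi r) <= (2 * PI - 0) * B).
{ apply abs_RInt_le_const; [ lra | now apply ex_RInt_P | ].
  intros t _; apply Rle_trans with (2 := HB _ (polar_in r t Hr')).
  unfold P; set (z := F (polar c r t)).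
  (* [(cos t, - sin t)] is e^(-it), of modulus 1, so the integrand is bounded by |F|. *)
  replace (fst z * cos t + snd z * sin t) with (fst (z * (cos t, - sin t)%R)%C)
    by (simpl; ring).
  apply Rle_trans with (1 := re_le_Cmod _); rewrite Cmod_mult.
  replace (Cmod (cos t, - sin t)) with 1; [ lra | ].
  unfold Cmod; simpl fst; simpl snd; rewrite <- sqrt_1 at 1; f_equal.
  generalize (sin2_cos2 t); unfold Rsqr; intros; nra. }
apply (Rle_trans _ _ _ (Rle_abs _)) in Ab.
rewrite E in Ab.
apply Rmult_le_reg_l with (2 * PI * r); [ nra | ].
replace (2 * PI * r * (B / r)) with (2 * PI * B) by (field; lra).
lra.
Qed.

End Cauchy.

(** The estimate for real parts is applied to e F with e = conj(F'(c)): the derivative at [c]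
    becomes |F'(c)|^2 and the bound |F'(c)| B, and a nonzero |F'(c)| cancels. *)
Lemma cauchy_estimate (F F' : C -> C) (c : C) (rho r B : R) :
  0 < r < rho ->
  (forall w, Cmod (w - c)%C < rho -> C_is_derive F w (F' w)) ->
  (forall w, Cmod (w - c)%C < rho -> C_continuous F' w) ->
  (forall w, Cmod (w - c)%C < rho -> Cmod (F w) <= B) ->
  Cmod (F' c) <= B / r.
Proof.
intros Hr HF HF' HB.
set (e := Cconj (F' c)).

assert (H := cauchy_estimate_re (fun w => e * F w)%C (fun w => e * F' w)%C c rho
  (fun w Hw => C_is_derive_scal _ e _ _ (HF w Hw))
  (fun w Hw => C_continuous_scal _ e _ (HF' w Hw)) (Cmod e * B) r Hr).
assert (Hp := Cmod_ge_0 (F' c)).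
destruct (Req_dec (Cmod (F' c)) 0) as [Z | Z].
{ rewrite Z; apply Rmult_le_pos; [ | left; apply Rinv_0_lt_compat; lra ].
  apply Rle_trans with (2 := HB c ltac:(replace (c - c)%C with (RtoC 0) by ring;
    rewrite Cmod_0; lra)).
  apply Cmod_ge_0. }
apply Rmult_le_reg_l with (Cmod (F' c)); [ lra | ].
replace (Cmod (F' c) * Cmod (F' c)) with (fst (e * F' c)%C).
2: { replace (Cmod (F' c) * Cmod (F' c)) with (Cmod (F' c) ^ 2) by ring.
  rewrite Cmod2_alt; unfold e, Re, Im; simpl; ring. }
apply Rle_trans with (Cmod e * B / r).
{ apply H; intros w Hw; rewrite Cmod_mult.
  apply Rmult_le_compat_l; [ apply Cmod_ge_0 | now apply HB ]. }
unfold e; rewrite Cmod_conj; right; unfold Rdiv; ring.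
Qed.

(** * Smoothness of analytic functions *)

Lemma Cmod_shift (z k w : C) : Cmod (z + k - w)%C <= Cmod (z - w)%C + Cmod k.
Proof.
replace (z + k - w)%C with ((z - w) + k)%C by ring; apply Cmod_triangle.
Qed.

(* The limit is the supremum of [f k - A |k|], so no sequence is needed. *)
Lemma real_limit_of_cauchy (f : C -> R) (delta A : R) :
  0 < delta ->
  (forall k l, 0 < Cmod k < delta -> 0 < Cmod l < delta ->
     Rabs (f k - f l) <= A * (Cmod k + Cmod l)) ->
  exists D, forall k, 0 < Cmod k < delta -> Rabs (f k - D) <= A * Cmod k.
Proof.
intros Hd H.
assert (K0 : 0 < Cmod (delta / 2)%R < delta) by (rewrite Cmod_R, Rabs_pos_eq; lra).
set (S := fun y => exists k, 0 < Cmod k < delta /\ y = f k - A * Cmod k).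
assert (UB : forall l, 0 < Cmod l < delta -> is_upper_bound S (f l + A * Cmod l)).
{ intros l Hl y [k [Hk ->]].
  specialize (H k l Hk Hl); apply (Rle_trans _ _ _ (Rle_abs _)) in H; lra. }
destruct (completeness S) as [D [D1 D2]].
- eexists; apply UB, K0.
- eexists; exists (RtoC (delta / 2)); split; [ exact K0 | reflexivity ].
- exists D; intros k Hk.
  assert (B1 := D2 _ (UB k Hk)).
  assert (B2 := D1 _ (ex_intro _ k (conj Hk eq_refl))).
  apply Rabs_le; lra.
Qed.

(** The factor 2 comes from treating the two coordinates separately. The rate is kept because it
    becomes the quadratic remainder in [C_derive_quadratic]. *)
Lemma C_limit_of_cauchy (g : C -> C) (delta A : R) :
  0 < delta ->
  (forall k l, 0 < Cmod k < delta -> 0 < Cmod l < delta ->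
     Cmod (g k - g l)%C <= A * (Cmod k + Cmod l)) ->
  exists D : C, forall k, 0 < Cmod k < delta -> Cmod (g k - D)%C <= 2 * A * Cmod k.
Proof.
intros Hd H.
destruct (real_limit_of_cauchy (fun k => fst (g k)) delta A Hd) as [D1 HD1].
{ intros k l Hk Hl; apply Rle_trans with (2 := H k l Hk Hl).
  exact (re_le_Cmod (g k - g l)%C). }
destruct (real_limit_of_cauchy (fun k => snd (g k)) delta A Hd) as [D2 HD2].
{ intros k l Hk Hl; apply Rle_trans with (2 := H k l Hk Hl).
  exact (im_le_Cmod (g k - g l)%C). }
exists (D1, D2); intros k Hk.
apply Rle_trans with (1 := Cmod_le_abs _).
specialize (HD1 k Hk); specialize (HD2 k Hk); unfold Rminus in HD1, HD2; simpl; lra.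
Qed.

Lemma C_is_derive_of_quadratic (G : C -> C) (z D : C) (delta A : R) :
  0 < delta ->
  (forall k, Cmod k < delta -> Cmod (G (z + k) - G z - k * D)%C <= A * Cmod k ^ 2) ->
  C_is_derive G z D.
Proof.
intros Hd H; apply C_is_derive_eps; intros eps.
assert (He : 0 < Rmin delta (eps / (1 + Rabs A))).
{ pose proof (Rabs_pos A).
  apply Rmin_pos; [ exact Hd | apply Rdiv_lt_0_compat; [ apply cond_pos | lra ] ]. }
exists (mkposreal _ He); simpl; intros k Hk.
apply Rle_trans with (1 := H k (Rlt_le_trans _ _ _ Hk (Rmin_l _ _))).
assert (K := Rlt_le_trans _ _ _ Hk (Rmin_r _ _)).
pose proof (Rabs_pos A); pose proof (Rle_abs A); pose proof (Cmod_ge_0 k).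
apply (Rmult_lt_compat_r (1 + Rabs A)) in K; [ | lra ].
replace (eps / (1 + Rabs A) * (1 + Rabs A)) with (pos eps) in K by (field; lra).
replace (A * Cmod k ^ 2) with ((A * Cmod k) * Cmod k) by ring.
apply Rmult_le_compat_r; [ assumption | nra ].
Qed.

(** Cauchy's estimate carries bounds on differences of [F] over to [F'], first for increments, then
    for differences of two difference quotients. Each use costs [rho] in the distance to [w]: 4, 3,
    then 2 times [rho]. Shifts by [k] stay within 8 times [rho]. That [A] does not depend on [z]
    will give the continuity of the second derivative. *)
Lemma C_derive_quadratic (F F' : C -> C) (w : C) (rho L : R) :
  0 < rho ->
  (forall z, Cmod (z - w)%C < 8 * rho -> C_is_derive F z (F' z)) ->
  (forall z, Cmod (z - w)%C < 8 * rho -> C_continuous F' z) ->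
  (forall z, Cmod (z - w)%C < 8 * rho -> Cmod (F' z) <= L) ->
  exists A : R, forall z, Cmod (z - w)%C < 2 * rho -> forall k, Cmod k < 4 * rho ->
    Cmod (F' (z + k) - F' z - k * C_derive F' z)%C <= A * Cmod k ^ 2.
Proof.
intros Hr HF HC HL.
assert (L0 : 0 <= L).
{ apply Rle_trans with (2 := HL w ltac:(replace (w - w)%C with (RtoC 0) by ring;
    rewrite Cmod_0; lra)), Cmod_ge_0. }
assert (tk : forall (t : R) k, 0 <= t <= 1 -> Cmod (t * k)%C <= Cmod k).
{ intros t k Ht; rewrite Cmod_mult, Cmod_R, Rabs_pos_eq by lra.
  pose proof (Cmod_ge_0 k); nra. }
assert (in8 : forall z k m, Cmod (z - w)%C < m -> Cmod k < 4 * rho -> m <= 4 * rho ->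
  Cmod (z + k - w)%C < 8 * rho).
{ intros z k m Hz Hk Hm; pose proof (Cmod_shift z k w); lra. }
assert (H1 : forall z k, Cmod (z - w)%C < 4 * rho -> Cmod k < 4 * rho ->
  Cmod (F (z + k) - F z)%C <= L * Cmod k).
{ intros z k Hz Hk; apply C_mean_value with F'; intros t Ht;
    [ apply HF | apply HL ]; apply (in8 _ _ (4 * rho)); try lra;
    apply Rle_lt_trans with (2 := Hk), tk, Ht. }
assert (near : forall z m x, Cmod (z - w)%C < m -> Cmod (x - z)%C < rho ->
  Cmod (x - w)%C < m + rho).
{ intros z m x Hz Hx; replace (x - w)%C with (z + (x - z) - w)%C by ring.
  pose proof (Cmod_shift z (x - z)%C w); lra. }
(* Cauchy's estimate on the disc of radius [rho], used with [r = rho / 2], multiplies a bound by 2 /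
   rho; likewise for [L2]. *)
set (L1 := L * 2 / rho).
assert (L10 : 0 <= L1).
{ unfold L1; apply Rmult_le_pos; [ lra | left; apply Rinv_0_lt_compat, Hr ]. }
assert (H2 : forall z k, Cmod (z - w)%C < 3 * rho -> Cmod k < 4 * rho ->
  Cmod (F' (z + k) - F' z)%C <= L1 * Cmod k).
{ intros z k Hz Hk.
  replace (L1 * Cmod k) with (L * Cmod k / (rho / 2)) by (unfold L1; field; lra).
  apply (cauchy_estimate (fun x => F (x + k) - F x)%C (fun x => F' (x + k) - F' x)%C
    z rho); [ lra | | | ]; intros x Hx; assert (Hx' := near _ _ _ Hz Hx).
  - apply C_is_derive_minus; [ apply C_is_derive_shift | ]; apply HF; [ | lra ].
    apply (in8 _ _ (4 * rho)); lra.
  - apply C_continuous_minus; [ apply C_continuous_shift | ]; apply HC; [ | lra ].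
    apply (in8 _ _ (4 * rho)); lra.
  - apply H1; lra. }
(* Subtracting the linear function F'(z) x leaves the derivative F'(x) - F'(z), which [H2] bounds on
   the segment. *)
assert (H3 : forall z k, Cmod (z - w)%C < 3 * rho -> Cmod k < 4 * rho ->
  Cmod (F (z + k) - F z - k * F' z)%C <= L1 * Cmod k * Cmod k).
{ intros z k Hz Hk.
  replace (F (z + k) - F z - k * F' z)%C
    with ((F (z + k) - F' z * (z + k)) - (F z - F' z * z))%C by ring.
  apply (C_mean_value (fun x => F x - F' z * x)%C (fun x => F' x - F' z * RtoC 1)%C);
    intros t Ht.
  - apply C_is_derive_minus; [ | apply C_is_derive_scal, C_is_derive_id ].
    apply HF, (in8 _ _ (4 * rho)); try lra.
    apply Rle_lt_trans with (2 := Hk), tk, Ht.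
  - replace (F' z * RtoC 1)%C with (F' z) by ring.
    apply Rle_trans with (L1 * Cmod (t * k)%C).
    + apply H2; [ lra | apply Rle_lt_trans with (2 := Hk), tk, Ht ].
    + apply Rmult_le_compat_l; [ lra | apply tk, Ht ]. }
set (L2 := L1 * 2 / rho).
assert (nz : forall k, 0 < Cmod k -> k <> RtoC 0) by (intros k Hk; now apply Cmod_gt_0).
assert (H4 : forall x k, Cmod (x - w)%C < 3 * rho -> 0 < Cmod k < 4 * rho ->
  Cmod (/ k * (F (x + k) - F x) - F' x)%C <= L1 * Cmod k).
{ intros x k Hx Hk.
  apply Rmult_le_reg_l with (Cmod k); [ lra | ].
  rewrite <- Cmod_mult.
  replace (k * (/ k * (F (x + k) - F x) - F' x))%C with (F (x + k) - F x - k * F' x)%C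
    by (field; apply nz; lra).
  rewrite (Rmult_comm (Cmod k)); apply H3; lra. }
(* By [H4] two difference quotients of [F] differ by at most L1 (|k| + |l|); Cauchy's estimate
   passes this to the quotients of [F'], which therefore converge. *)
assert (H5 : forall z, Cmod (z - w)%C < 2 * rho ->
  exists D, forall k, 0 < Cmod k < 4 * rho ->
    Cmod (/ k * (F' (z + k) - F' z) - D)%C <= 2 * L2 * Cmod k).
{ intros z Hz; apply C_limit_of_cauchy; [ lra | ].
  intros k l Hk Hl.
  replace (L2 * (Cmod k + Cmod l)) with (L1 * (Cmod k + Cmod l) / (rho / 2))
    by (unfold L2; field; lra).
  apply (cauchy_estimate
    (fun x => / k * (F (x + k) - F x) - / l * (F (x + l) - F x))%C
    (fun x => / k * (F' (x + k) - F' x) - / l * (F' (x + l) - F' x))%C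
    z rho); [ lra | | | ]; intros x Hx; assert (Hx' := near _ _ _ Hz Hx).
  - apply C_is_derive_minus; apply C_is_derive_scal, C_is_derive_minus;
      [ apply C_is_derive_shift | | apply C_is_derive_shift | ]; apply HF; try lra;
      apply (in8 _ _ (3 * rho)); lra.
  - apply C_continuous_minus; apply C_continuous_scal, C_continuous_minus;
      [ apply C_continuous_shift | | apply C_continuous_shift | ]; apply HC; try lra;
      apply (in8 _ _ (3 * rho)); lra.
  - replace (/ k * (F (x + k) - F x) - / l * (F (x + l) - F x))%C
      with ((/ k * (F (x + k) - F x) - F' x) + - (/ l * (F (x + l) - F x) - F' x))%C
      by ring.
    apply Rle_trans with (1 := Cmod_triangle _ _); rewrite Cmod_opp.
    rewrite Rmult_plus_distr_l; apply Rplus_le_compat; apply H4; lra. }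
exists (2 * L2); intros z Hz.
destruct (H5 z Hz) as [D HD].
assert (Q : forall k, Cmod k < 4 * rho ->
  Cmod (F' (z + k) - F' z - k * D)%C <= 2 * L2 * Cmod k ^ 2).
{ intros k Hk; destruct (Ceq_dec k (RtoC 0)) as [-> | K].
  - replace (F' (z + RtoC 0) - F' z - RtoC 0 * D)%C with (RtoC 0)
      by (replace (z + RtoC 0)%C with z by ring; ring).
    rewrite Cmod_0; right; ring.
  - replace (F' (z + k) - F' z - k * D)%C
      with (k * (/ k * (F' (z + k) - F' z) - D))%C by (field; exact K).
    rewrite Cmod_mult.
    apply Cmod_gt_0 in K.
    replace (2 * L2 * Cmod k ^ 2) with (Cmod k * (2 * L2 * Cmod k)) by ring.
    apply Rmult_le_compat_l; [ lra | apply HD; lra ]. }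
replace (C_derive F' z) with D; [ exact Q | ].
symmetry; apply is_C_derive_unique.
apply C_is_derive_of_quadratic with (2 := Q); lra.
Qed.

(** Continuity of [F'] bounds it near [w], so [C_derive_quadratic] applies there. Its expansion at
    [w] gives the derivative of [F']; comparing the expansions at [w] and at [w + k] gives the
    continuity of that derivative. *)
Lemma C_derive_C1 (F : C -> C) (w : C) (rho : R) :
  0 < rho ->
  (forall z, Cmod (z - w)%C < rho -> C_ex_derive F z) ->
  (forall z, Cmod (z - w)%C < rho -> C_continuous (C_derive F) z) ->
  C_ex_derive (C_derive F) w /\ C_continuous (C_derive (C_derive F)) w.
Proof.
intros Hr HF HC.
assert (w0 : Cmod (w - w)%C = 0)
  by (replace (w - w)%C with (RtoC 0) by ring; apply Cmod_0).
destruct (proj1 (C_continuous_eps _ _) (HC w ltac:(lra)) (mkposreal _ Rlt_0_1))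
  as [d Hd]; simpl in Hd.
(* [C_derive_quadratic] asks for a disc of radius [8 * s], inside which both the hypotheses and the
   bound on [F'] must hold. *)
set (s := Rmin rho d / 8).
assert (Hs : 0 < s) by (unfold s; pose proof (Rmin_pos _ _ Hr (cond_pos d)); lra).
assert (Hs1 : 8 * s <= rho) by (unfold s; pose proof (Rmin_l rho d); lra).
assert (Hs2 : 8 * s <= d) by (unfold s; pose proof (Rmin_r rho d); lra).
destruct (C_derive_quadratic F (C_derive F) w s (1 + Cmod (C_derive F w)) Hs)
  as [A HA].
- intros z Hz; apply (C_derive_correct F z z), HF; lra.
- intros z Hz; apply HC; lra.
- intros z Hz.
  specialize (Hd (z - w)%C ltac:(lra)).
  replace (w + (z - w))%C with z in Hd by ring.
  replace (C_derive F z) with ((C_derive F z - C_derive F w) + C_derive F w)%C by ring.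
  apply Rle_trans with (1 := Cmod_triangle _ _); lra.
- split.
  + exists (C_derive (C_derive F) w).
    apply C_is_derive_of_quadratic with (4 * s) A; [ lra | apply HA; lra ].
  + set (G := C_derive F) in *; set (D := C_derive G) in *.
    apply C_continuous_eps; intros eps.
    assert (HA0 := Rabs_pos A).
    assert (He : 0 < Rmin s (eps / (1 + 2 * Rabs A))).
    { apply Rmin_pos; [ exact Hs | apply Rdiv_lt_0_compat; [ apply cond_pos | lra ] ]. }
    exists (mkposreal _ He); simpl; intros k Hk.
    assert (K1 := Rlt_le_trans _ _ _ Hk (Rmin_l _ _)).
    assert (K2 := Rlt_le_trans _ _ _ Hk (Rmin_r _ _)).
    apply (Rmult_lt_compat_r (1 + 2 * Rabs A)) in K2; [ | lra ].
    replace (eps / (1 + 2 * Rabs A) * (1 + 2 * Rabs A)) with (pos eps) in K2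
      by (field; lra).
    assert (K0 := Cmod_ge_0 k).
    destruct (Ceq_dec k (RtoC 0)) as [-> | K].
    { replace (w + RtoC 0)%C with w by ring.
      replace (D w - D w)%C with (RtoC 0) by ring.
      rewrite Cmod_0; left; apply cond_pos. }
    apply Cmod_gt_0 in K.
    (* Expand [G] from [w] to [w + k] and back, and add. *)
    assert (Q1 := HA w ltac:(lra) k ltac:(lra)).
    assert (Q2 := HA (w + k)%C
      ltac:(replace (w + k - w)%C with k by ring; lra) (- k)%C
      ltac:(rewrite Cmod_opp; lra)).
    rewrite Cmod_opp in Q2.
    replace (w + k + - k)%C with w in Q2 by ring.
    assert (Q : Cmod (k * (D (w + k) - D w))%C <= 2 * A * Cmod k ^ 2).
    { replace (k * (D (w + k) - D w))%C with
        ((G (w + k) - G w - k * D w) + (G w - G (w + k) - - k * D (w + k)))%C by ring.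
      apply Rle_trans with (1 := Cmod_triangle _ _); lra. }
    rewrite Cmod_mult in Q.
    apply Rmult_le_reg_l with (Cmod k); [ exact K | ].
    apply Rle_trans with (1 := Q).
    pose proof (Rle_abs A); nra.
Qed.

(** * Normal harmonic mappings *)

Lemma unit_disc_near (z w : C) : Cmod (w - z)%C < 1 - Cmod z -> unit_disc w.
Proof.
intros H; unfold unit_disc.
replace w with ((w - z) + z)%C by ring.
apply Rle_lt_trans with (1 := Cmod_triangle _ _); lra.
Qed.

(** The two conclusions together, at all points of the disc, are what [C_derive_C1] asks for at the
    next order. *)
Lemma C_derive_n_C1 (h : C -> C) :
  analytic_in_disc h ->
  (forall z, unit_disc z -> C_continuous (C_derive h) z) ->
  forall n z, unit_disc z ->
    C_ex_derive (C_derive_n h n) z /\ C_continuous (C_derive_n h (S n)) z.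
Proof.
intros Hh Hc; induction n as [ | n IH ]; intros z Hz.
- split; [ now apply Hh | now apply Hc ].
- apply (C_derive_C1 (C_derive_n h n) z (1 - Cmod z)).
  + unfold unit_disc in Hz; lra.
  + intros w Hw; apply IH, unit_disc_near with (1 := Hw).
  + intros w Hw; apply IH, unit_disc_near with (1 := Hw).
Qed.

(** Lets Cauchy's estimates of order [n] start from h', the function that normality controls. *)
Lemma C_derive_n_succ (h : C -> C) (n : nat) :
  C_derive_n h (S n) = C_derive_n (C_derive h) n.
Proof.
induction n as [ | n IH ]; [ reflexivity | ].
change (C_derive (C_derive_n h (S n)) = C_derive (C_derive_n (C_derive h) n)).
now rewrite IH.
Qed.

(** Each differentiation gives up a margin [r] of the disc and costs a factor 1 / r. *)
Lemma cauchy_estimate_n (G : C -> C) (c : C) (rho r B : R) :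
  0 < r ->
  (forall n z, Cmod (z - c)%C < rho ->
    C_ex_derive (C_derive_n G n) z /\ C_continuous (C_derive_n G (S n)) z) ->
  (forall z, Cmod (z - c)%C < rho -> Cmod (G z) <= B) ->
  forall n z, Cmod (z - c)%C < rho - INR n * r ->
    Cmod (C_derive_n G n z) <= B / r ^ n.
Proof.
intros Hr HG HB; induction n as [ | n IH ]; intros z Hz.
- simpl in *; unfold Rdiv; rewrite Rinv_1, Rmult_1_r; apply HB; lra.
- rewrite S_INR in Hz.
  assert (Hn : 0 <= INR n * r) by (apply Rmult_le_pos; [ apply pos_INR | lra ]).
  (* The distance from [z] to the edge of the disc of the previous step; it exceeds [r] by [Hz]. *)
  set (rho' := rho - INR n * r - Cmod (z - c)%C).
  assert (near : forall w, Cmod (w - z)%C < rho' -> Cmod (w - c)%C < rho - INR n * r).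
  { intros w Hw; replace (w - c)%C with ((w - z) + (z - c))%C by ring.
    apply Rle_lt_trans with (1 := Cmod_triangle _ _); unfold rho' in Hw; lra. }
  replace (B / r ^ S n) with (B / r ^ n / r)
    by (unfold Rdiv; rewrite <- tech_pow_Rmult, Rinv_mult; ring).
  apply (cauchy_estimate (C_derive_n G n) (C_derive_n G (S n)) z rho').
  + unfold rho'; lra.
  + intros w Hw; apply (C_derive_correct _ w w), HG; specialize (near w Hw); lra.
  + intros w Hw; apply HG; specialize (near w Hw); lra.
  + intros w Hw; apply IH, near, Hw.
Qed.

(** Used along coordinate lines to read off h' and g' from the partial derivatives of [f], and along
    segments to bound the growth of [f]. *)
Lemma canonical_curve (f h g : C -> C) (p q : R -> R) (t dp dq : R) :
  canonical_decomposition f h g -> unit_disc (p t, q t) ->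
  is_derive p t dp -> is_derive q t dq ->
  let d := (C_derive h (p t, q t) * (dp, dq) +
            Cconj (C_derive g (p t, q t) * (dp, dq)))%C in
  is_derive (fun s => Re (f (p s, q s))) t (fst d) /\
  is_derive (fun s => Im (f (p s, q s))) t (snd d).
Proof.
intros [Hh [Hg Hf]] Hz Hp Hq d.
(* The decomposition of [f] holds in the disc only, so the curve has to stay there for parameters
   near [t]. *)
assert (L : locally t (fun s => unit_disc (p s, q s))).
{ assert (Cp : continuous p t) by (apply (ex_derive_continuous p); now exists dp).
  assert (Cq : continuous q t) by (apply (ex_derive_continuous q); now exists dq).
  assert (He : 0 < (1 - Cmod (p t, q t)) / 2) by (unfold unit_disc in Hz; lra).
  set (e := mkposreal _ He).
  generalize (filter_and _ _ (proj1 (filterlim_locally _ _) Cp e)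
    (proj1 (filterlim_locally _ _) Cq e)); apply filter_imp.
  intros s [B1 B2]; apply unit_disc_near with ((p t, q t)).
  change (Rabs (p s - p t) < (1 - Cmod (p t, q t)) / 2) in B1.
  change (Rabs (q s - q t) < (1 - Cmod (p t, q t)) / 2) in B2.
  apply Rle_lt_trans with (1 := Cmod_le_abs _); simpl; unfold Rminus in *; lra. }
destruct (is_derive_C_curve h p q t dp dq _
  (C_derive_correct _ _ (RtoC 0) (Hh _ Hz)) Hp Hq) as [h1 h2].
destruct (is_derive_C_curve g p q t dp dq _
  (C_derive_correct _ _ (RtoC 0) (Hg _ Hz)) Hp Hq) as [g1 g2].
split.
- apply is_derive_ext_loc with (fun s => fst (h (p s, q s)) + fst (g (p s, q s))).
  + revert L; apply filter_imp; intros s Hs; rewrite (Hf _ Hs); reflexivity.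
  + evar_last; [ exact (is_derive_plus _ _ _ _ _ h1 g1) | ].
    unfold d, plus; simpl; ring.
- apply is_derive_ext_loc with (fun s => snd (h (p s, q s)) - snd (g (p s, q s))).
  + revert L; apply filter_imp; intros s Hs; rewrite (Hf _ Hs); reflexivity.
  + evar_last; [ exact (is_derive_minus _ _ _ _ _ h2 g2) | ].
    unfold d, minus, plus, opp; simpl; ring.
Qed.

(* [h'] and [conj g'] are the Wirtinger derivatives of [f]. *)
Lemma canonical_derivatives (f h g : C -> C) (x y : R) :
  canonical_decomposition f h g -> unit_disc (x, y) ->
  C_derive h (x, y) =
    ((Derive (fun t => Re (f (t, y))) x + Derive (fun t => Im (f (x, t))) y) / 2,
     (Derive (fun t => Im (f (t, y))) x - Derive (fun t => Re (f (x, t))) y) / 2)%R /\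
  C_derive g (x, y) =
    ((Derive (fun t => Re (f (t, y))) x - Derive (fun t => Im (f (x, t))) y) / 2,
     (- Derive (fun t => Im (f (t, y))) x - Derive (fun t => Re (f (x, t))) y) / 2)%R.
Proof.
intros Hd Hz.
destruct (canonical_curve f h g (fun t => t) (fun _ => y) x 1 0 Hd Hz) as [a1 a2].
{ apply (is_derive_id x). }
{ apply (is_derive_const y x). }
destruct (canonical_curve f h g (fun _ => x) (fun t => t) y 0 1 Hd Hz) as [b1 b2].
{ apply (is_derive_const x y). }
{ apply (is_derive_id y). }
rewrite (is_derive_unique (fun t : R => Re (f (t, y))) x _ a1).
rewrite (is_derive_unique (fun t : R => Im (f (t, y))) x _ a2).
rewrite (is_derive_unique (fun t : R => Re (f (x, t))) y _ b1).
rewrite (is_derive_unique (fun t : R => Im (f (x, t))) y _ b2).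
destruct (C_derive h (x, y)), (C_derive g (x, y)); simpl.
split; apply injective_projections; simpl; field.
Qed.

Lemma C_continuous_components (a b : R -> R -> R) (x y : R) :
  continuity_2d_pt a x y -> continuity_2d_pt b x y ->
  C_continuous (fun z => (a (fst z) (snd z), b (fst z) (snd z))) (x, y).
Proof.
intros Ha Hb.
apply continuity_2d_pt_filterlim in Ha; apply continuity_2d_pt_filterlim in Hb.
apply (continuous_comp_2 (fun z : R * R => a (fst z) (snd z))
  (fun z : R * R => b (fst z) (snd z)) (fun u v => (u, v)) (x, y) Ha Hb).
apply continuous_ext with (f := fun q => q); [ now intros [u v] | apply continuous_id ].
Qed.

Lemma canonical_C1 (f h g : C -> C) :
  harmonic_mapping f -> canonical_decomposition f h g ->
  forall z, unit_disc z ->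
    C_continuous (C_derive h) z /\ C_continuous (C_derive g) z.
Proof.
intros [Hre Him] Hd [x y] Hz.
(* From [ex_diff_n] only the continuity of the first partial derivatives is extracted: [ux], [uy]
   for the real part of [f], then [vx], [vy] for the imaginary part. *)
destruct (Hre x y Hz) as [[_ [_ [_ [[ux _] [uy _]]]]] _].
destruct (Him x y Hz) as [[_ [_ [_ [[vx _] [vy _]]]]] _].
assert (L : locally ((x, y) : C) unit_disc).
{ assert (He : 0 < (1 - Cmod (x, y)) / 2) by (unfold unit_disc in Hz; lra).
  exists (mkposreal _ He); intros w [B1 B2]; apply unit_disc_near with (x, y).
  change (Rabs (fst w - x) < (1 - Cmod (x, y)) / 2) in B1.
  change (Rabs (snd w - y) < (1 - Cmod (x, y)) / 2) in B2.
  apply Rle_lt_trans with (1 := Cmod_le_abs _); simpl; unfold Rminus in *; lra. }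
assert (half : forall a, continuity_2d_pt a x y ->
  continuity_2d_pt (fun s t => a s t / 2) x y).
{ intros a Ha; apply (continuity_2d_pt_mult a (fun _ _ => / 2));
  [ exact Ha | apply continuity_2d_pt_const ]. }
split.
- eapply continuous_ext_loc; [ | apply C_continuous_components;
    [ exact (half _ (continuity_2d_pt_plus _ _ _ _ ux vy))
    | exact (half _ (continuity_2d_pt_minus _ _ _ _ vx uy)) ] ].
  revert L; apply filter_imp; intros [s t] Hw; symmetry.
  exact (proj1 (canonical_derivatives f h g s t Hd Hw)).
- eapply continuous_ext_loc; [ | apply C_continuous_components;
    [ exact (half _ (continuity_2d_pt_minus _ _ _ _ ux vy))
    | exact (half _ (continuity_2d_pt_minus _ _ _ _
        (continuity_2d_pt_opp _ _ _ vx) uy)) ] ].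
  revert L; apply filter_imp; intros [s t] Hw; symmetry.
  exact (proj2 (canonical_derivatives f h g s t Hd Hw)).
Qed.

(** The partial derivatives of [f] determine h' and g'. This transfers the bound known for one
    decomposition to all of them. *)
Lemma sharp_canonical (f h g h0 g0 : C -> C) (z : C) :
  canonical_decomposition f h g -> canonical_decomposition f h0 g0 ->
  unit_disc z -> sharp f h g z = sharp f h0 g0 z.
Proof.
destruct z as [x y]; intros Hd Hd0 Hz; unfold sharp.
destruct (canonical_derivatives f h g x y Hd Hz) as [-> ->].
now destruct (canonical_derivatives f h0 g0 x y Hd0 Hz) as [-> ->].
Qed.

(* Where [|f|' <= A (1 + |f|^2)], the function [1 / sqrt (1 + |f|^2)] is
   [A]-Lipschitz; unlike [atan |f|] it is differentiable at the zeros of [f]. *)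
Lemma inv_sqrt_lipschitz (p q dp dq : R -> R) (A : R) :
  (forall t, 0 <= t <= 1 -> is_derive p t (dp t)) ->
  (forall t, 0 <= t <= 1 -> is_derive q t (dq t)) ->
  (forall t, 0 <= t <= 1 -> Cmod (dp t, dq t) <= A * (1 + p t ^ 2 + q t ^ 2)) ->
  / sqrt (1 + p 0 ^ 2 + q 0 ^ 2) - A <= / sqrt (1 + p 1 ^ 2 + q 1 ^ 2).
Proof.
intros Hp Hq HA.
set (N := fun t => 1 + p t ^ 2 + q t ^ 2).
assert (N1 : forall t, 1 <= N t) by (intros t; unfold N; nra).
set (dW := fun t => - (p t * dp t + q t * dq t) / (N t * sqrt (N t))).
assert (HW : forall t, 0 <= t <= 1 -> is_derive (fun s => / sqrt (N s)) t (dW t)).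
{ intros t Ht; specialize (Hp t Ht); specialize (Hq t Ht); specialize (N1 t).
  assert (S0 : 0 < sqrt (N t)) by (apply sqrt_lt_R0; lra).
  unfold N in *.
  auto_derive.
  - repeat split; [ now exists (dp t) | now exists (dq t) | simpl in N1; lra | ].
    simpl in S0; lra.
  - rewrite (is_derive_unique (fun x : R => p x) t _ Hp).
    rewrite (is_derive_unique (fun x : R => q x) t _ Hq).
    change (p t * (p t * 1)) with (p t ^ 2); change (q t * (q t * 1)) with (q t ^ 2).
    unfold dW, N; set (m := sqrt _) in *.
    replace (1 + p t ^ 2 + q t ^ 2) with (m * m) by (unfold m; apply sqrt_sqrt; lra).
    field; lra. }
destruct (MVT_gen (fun s => / sqrt (N s)) 0 1 dW) as [t [Ht E]].
{ rewrite Rmin_left, Rmax_right by lra; intros t Ht; apply HW; lra. }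
{ rewrite Rmin_left, Rmax_right by lra; intros t Ht.
  apply continuity_pt_filterlim, (ex_derive_continuous (fun s => / sqrt (N s))).
  eexists; now apply HW. }
rewrite Rmin_left, Rmax_right in Ht by lra.
fold (N 0) (N 1).
assert (B : - A <= dW t); [ | lra ].
specialize (HA t Ht); fold (N t) in HA; specialize (N1 t).
assert (S0 : 0 < sqrt (N t)) by (apply sqrt_lt_R0; lra).
assert (SS : sqrt (N t) * sqrt (N t) = N t) by (apply sqrt_sqrt; lra).
(* The Cauchy-Schwarz inequality, obtained from the real part of conj(p + iq) (dp + i dq). Dividing
   by [N t * sqrt (N t)] leaves exactly [A]. *)
assert (I : p t * dp t + q t * dq t <= sqrt (N t) * (A * N t)).
{ replace (p t * dp t + q t * dq t) with (fst (Cconj (p t, q t) * (dp t, dq t))%C)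
    by (simpl; ring).
  apply Rle_trans with (1 := Rle_abs _), Rle_trans with (1 := re_le_Cmod _).
  rewrite Cmod_mult, Cmod_conj.
  apply Rmult_le_compat; try apply Cmod_ge_0; [ | exact HA ].
  unfold Cmod; apply sqrt_le_1_alt; unfold N; simpl; nra. }
unfold dW, Rdiv; rewrite Ropp_mult_distr_l_reverse; apply Ropp_le_contravar.
apply Rmult_le_reg_r with (N t * sqrt (N t)); [ nra | ].
rewrite Rmult_assoc, Rinv_l by nra; lra.
Qed.

(** At [z] the function 1 / sqrt (1 + |f|^2) is at least [a = / sqrt (1 + K ^ 2)]. The radius is
    chosen so that it loses at most a / 2 on the way to [z + k]; hence 1 + |f|^2 is at most 4 (1 +
    K^2) there. *)
Lemma normal_local_bound (K M : R) (f h g : C -> C) (z k : C) :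
  canonical_decomposition f h g ->
  (forall w, unit_disc w -> (1 - Cmod w ^ 2) * sharp f h g w <= M) ->
  1 <= M -> unit_disc z -> Cmod (f z) <= K ->
  Cmod k <= / sqrt (1 + K ^ 2) / (4 * M) * (1 - Cmod z) ->
  Cmod (C_derive h (z + k)%C) + Cmod (C_derive g (z + k)%C)
    <= 8 * M * (1 + K ^ 2) / (1 - Cmod z).
Proof.
intros Hd HM M1 Hz HK Hk.
set (d := 1 - Cmod z) in *.
assert (d0 : 0 < d) by (unfold d; unfold unit_disc in Hz; lra).
set (a := / sqrt (1 + K ^ 2)) in *.
assert (S1 : 1 <= sqrt (1 + K ^ 2)).
{ apply Rle_trans with (sqrt 1); [ rewrite sqrt_1; lra | apply sqrt_le_1_alt; nra ]. }
assert (SS : sqrt (1 + K ^ 2) * sqrt (1 + K ^ 2) = 1 + K ^ 2) by (apply sqrt_sqrt; nra).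
assert (a0 : 0 < a) by (apply Rinv_0_lt_compat; lra).
assert (a1 : a <= 1).
{ unfold a; apply Rle_trans with (/ 1); [ apply Rinv_le_contravar; lra | ].
  rewrite Rinv_1; lra. }
assert (Hk4 : Cmod k * (4 * M) <= a * d).
{ replace (a * d) with (a / (4 * M) * d * (4 * M)) by (field; lra).
  apply Rmult_le_compat_r; lra. }
assert (Hk2 : Cmod k <= d / 2) by (pose proof (Cmod_ge_0 k); nra).
set (p1 := fun t => fst z + t * fst k); set (p2 := fun t => snd z + t * snd k).
assert (Ez : forall t : R, (p1 t, p2 t) = (z + t * k)%C).
{ intros t; unfold p1, p2; destruct z, k; apply injective_projections; simpl; ring. }
assert (dist : forall t, 0 <= t <= 1 -> Cmod (p1 t, p2 t) <= 1 - d / 2).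
{ intros t Ht; rewrite Ez; apply Rle_trans with (1 := Cmod_triangle _ _).
  rewrite Cmod_mult, Cmod_R, Rabs_pos_eq by lra; unfold d in *.
  pose proof (Cmod_ge_0 k); nra. }
assert (Hin : forall t, 0 <= t <= 1 -> unit_disc (p1 t, p2 t)).
{ intros t Ht; unfold unit_disc; specialize (dist t Ht); lra. }
(* On the segment 1 - |w|^2 >= 1 - |w| >= d / 2, which turns normality into a differential
   inequality for [f]. *)
assert (HS : forall t, 0 <= t <= 1 ->
  Cmod (C_derive h (p1 t, p2 t)) + Cmod (C_derive g (p1 t, p2 t))
    <= 2 * M / d * (1 + Cmod (f (p1 t, p2 t)) ^ 2)).
{ intros t Ht; specialize (HM _ (Hin t Ht)); specialize (dist t Ht); revert HM dist.
  unfold sharp; set (w := (p1 t, p2 t)).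
  set (s := Cmod (C_derive h w) + Cmod (C_derive g w)).
  assert (s0 : 0 <= s) by (apply Rplus_le_le_0_compat; apply Cmod_ge_0).
  set (N := 1 + Cmod (f w) ^ 2).
  assert (N1 : 1 <= N) by (unfold N; nra).
  pose proof (Cmod_ge_0 w); intros HM dist.
  assert (D : d / 2 <= 1 - Cmod w ^ 2) by nra.
  assert (sN : 0 <= s / N)
    by (apply Rmult_le_pos; [ exact s0 | left; apply Rinv_0_lt_compat; lra ]).
  assert (E : d / 2 * (s / N) <= M).
  { apply Rle_trans with (2 := HM); now apply Rmult_le_compat_r. }
  replace s with (d / 2 * (s / N) * (2 / d * N)) by (field; lra).
  replace (2 * M / d * N) with (M * (2 / d * N)) by (field; lra).
  apply Rmult_le_compat_r; [ | exact E ].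
  apply Rmult_le_pos; [ left; apply Rdiv_lt_0_compat; lra | lra ]. }
assert (I : / sqrt (1 + Cmod (f (p1 0, p2 0)) ^ 2) - 2 * M / d * Cmod k
  <= / sqrt (1 + Cmod (f (p1 1, p2 1)) ^ 2)).
{ rewrite !Cmod2_alt, <- !Rplus_assoc.
  set (df := fun t => (C_derive h (p1 t, p2 t) * (fst k, snd k) +
            Cconj (C_derive g (p1 t, p2 t) * (fst k, snd k)))%C).
  apply (inv_sqrt_lipschitz (fun t => Re (f (p1 t, p2 t))) (fun t => Im (f (p1 t, p2 t)))
    (fun t => fst (df t)) (fun t => snd (df t))).
  - intros t Ht; apply (canonical_curve f h g p1 p2 t (fst k) (snd k) Hd (Hin t Ht));
    unfold p1, p2; auto_derive; trivial; ring.
  - intros t Ht; apply (canonical_curve f h g p1 p2 t (fst k) (snd k) Hd (Hin t Ht));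
    unfold p1, p2; auto_derive; trivial; ring.
  - intros t Ht.
    replace (fst (df t), snd (df t)) with (df t) by now destruct (df t).
    unfold df; replace (fst k, snd k) with k by now destruct k.
    apply Rle_trans with (1 := Cmod_triangle _ _).
    rewrite Cmod_conj, !Cmod_mult, <- Rmult_plus_distr_r.
    rewrite (Rmult_comm (2 * M / d)), Rmult_assoc, Rmult_comm.
    rewrite Rmult_comm, (Rmult_comm _ (Cmod k)).
    apply Rmult_le_compat_l; [ apply Cmod_ge_0 | ].
    rewrite Rplus_assoc, <- Cmod2_alt; apply HS, Ht. }
specialize (HS 1 ltac:(lra)).
assert (E0 : (p1 0, p2 0) = z).
{ unfold p1, p2; destruct z; apply injective_projections; simpl; ring. }
assert (E1 : (p1 1, p2 1) = (z + k)%C).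
{ unfold p1, p2; destruct z, k; apply injective_projections; simpl; ring. }
rewrite E0, E1 in I; rewrite E1 in HS.
apply Rle_trans with (1 := HS).
set (N := 1 + Cmod (f (z + k)%C) ^ 2) in *.
assert (N1 : 1 <= N) by (unfold N; nra).
assert (W0 : a <= / sqrt (1 + Cmod (f z) ^ 2)).
{ unfold a; pose proof (Cmod_ge_0 (f z)).
  apply Rinv_le_contravar; [ apply sqrt_lt_R0; nra | apply sqrt_le_1_alt; nra ]. }
assert (W1 : a / 2 <= / sqrt N).
{ assert (2 * M / d * Cmod k <= a / 2); [ | lra ].
  apply Rmult_le_reg_r with d; [ exact d0 | ].
  replace (2 * M / d * Cmod k * d) with (Cmod k * (4 * M) / 2) by (field; lra).
  lra. }
assert (SN : sqrt N * sqrt N = N) by (apply sqrt_sqrt; lra).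
assert (SN0 : 0 < sqrt N) by (apply sqrt_lt_R0; lra).
assert (SNb : sqrt N <= 2 * sqrt (1 + K ^ 2)).
{ rewrite <- (Rinv_inv (sqrt N)).
  replace (2 * sqrt (1 + K ^ 2)) with (/ (a / 2)) by (unfold a; field; lra).
  apply Rinv_le_contravar; lra. }
replace (8 * M * (1 + K ^ 2) / d) with (2 * M / d * (4 * (1 + K ^ 2))) by (field; lra).
apply Rmult_le_compat_l; [ left; apply Rdiv_lt_0_compat; lra | nra ].
Qed.

Theorem theorem3 :
  forall (K : R) (f : C -> C),
    0 < K ->
    normal_harmonic_mapping f ->
    forall n : nat, (1 <= n)%nat ->
      exists E : R,
        forall h g : C -> C, canonical_decomposition f h g ->
          forall z : C, unit_disc z -> Cmod (f z) <= K ->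
            (1 - Cmod z ^ 2) ^ n *
              (Cmod (C_derive_n h n z) + Cmod (C_derive_n g n z)) <= E.
Proof.
intros K f HK [Hf [h0 [g0 [Hd0 [M0 HM0]]]]] n Hn.
destruct n as [ | m ]; [ lia | ]; clear Hn.
(* [M >= 1] keeps [c] below 1, so that the disc of radius [c * d] about [z] lies in the unit
   disc. *)
set (M := Rmax 1 M0).
assert (M1 : 1 <= M) by apply Rmax_l.
set (c := / sqrt (1 + K ^ 2) / (4 * M)).
assert (c0 : 0 < c).
{ apply Rdiv_lt_0_compat; [ apply Rinv_0_lt_compat, sqrt_lt_R0; nra | lra ]. }
set (b := 8 * M * (1 + K ^ 2)).
assert (m0 : 0 < INR (S m)) by (apply lt_0_INR; lia).
(* The first power of 2 comes from 1 - |z|^2 <= 2 d with d = 1 - |z|, the next 2 from adding the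
   bounds for [h] and [g]. The rest is b / d / r^m with r = c d / (m + 1), freed of its factor 1 /
   d^(m + 1). *)
exists (2 ^ S m * (2 * (b * (INR (S m) / c) ^ m))).
intros h g Hd z Hz Hfz.
assert (Hsharp : forall w, unit_disc w -> (1 - Cmod w ^ 2) * sharp f h g w <= M).
{ intros w Hw; rewrite (sharp_canonical f h g h0 g0 w Hd Hd0 Hw).
  apply Rle_trans with (1 := HM0 w Hw), Rmax_r. }
set (d := 1 - Cmod z).
assert (d0 : 0 < d) by (unfold d; unfold unit_disc in Hz; lra).
assert (Hc1 : c <= 1).
{ unfold c; assert (S1 : 1 <= sqrt (1 + K ^ 2))
    by (apply Rle_trans with (sqrt 1); [ rewrite sqrt_1; lra | apply sqrt_le_1_alt; nra ]).
  apply Rmult_le_reg_r with (4 * M); [ lra | ].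
  replace (/ sqrt (1 + K ^ 2) / (4 * M) * (4 * M)) with (/ sqrt (1 + K ^ 2))
    by (field; lra).
  apply Rle_trans with (/ 1); [ apply Rinv_le_contravar; lra | ].
  rewrite Rinv_1; lra. }
assert (near : forall w, Cmod (w - z)%C < c * d -> unit_disc w).
{ intros w Hw; apply unit_disc_near with z; fold d; nra. }
assert (bound : forall w, Cmod (w - z)%C < c * d ->
  Cmod (C_derive h w) + Cmod (C_derive g w) <= b / d).
{ intros w Hw; replace w with (z + (w - z))%C by ring.
  apply (normal_local_bound K M f); trivial; fold d c; lra. }
(* The estimates for h' take [m] steps of length [r]; dividing by m + 1 leaves a margin [r], so the
   centre [z] is still covered. *)
set (r := c * d / INR (S m)).
assert (r0 : 0 < r) by (apply Rdiv_lt_0_compat; nra).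
assert (est : forall e : C -> C, analytic_in_disc e ->
  (forall w, unit_disc w -> C_continuous (C_derive e) w) ->
  (forall w, Cmod (w - z)%C < c * d -> Cmod (C_derive e w) <= b / d) ->
  Cmod (C_derive_n e (S m) z) <= b / d / r ^ m).
{ intros e He Ce Be; rewrite C_derive_n_succ.
  apply (cauchy_estimate_n (C_derive e) z (c * d)); trivial.
  - intros j w Hw; rewrite <- !C_derive_n_succ.
    apply C_derive_n_C1; trivial; now apply near.
  - replace (z - z)%C with (RtoC 0) by ring; rewrite Cmod_0.
    replace (c * d) with (INR (S m) * r) by (unfold r; field; lra).
    rewrite S_INR; nra. }
destruct Hd as [Hh [Hg Hfhg]].
assert (Hd : canonical_decomposition f h g) by (repeat split; trivial).
assert (Bh : Cmod (C_derive_n h (S m) z) <= b / d / r ^ m).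
{ apply est; [ exact Hh | | ]; intros w Hw.
  - exact (proj1 (canonical_C1 f h g Hf Hd w Hw)).
  - apply Rle_trans with (2 := bound w Hw); pose proof (Cmod_ge_0 (C_derive g w)); lra. }
assert (Bg : Cmod (C_derive_n g (S m) z) <= b / d / r ^ m).
{ apply est; [ exact Hg | | ]; intros w Hw.
  - exact (proj2 (canonical_C1 f h g Hf Hd w Hw)).
  - apply Rle_trans with (2 := bound w Hw); pose proof (Cmod_ge_0 (C_derive h w)); lra. }
assert (z0 := Cmod_ge_0 z).
apply Rle_trans with ((2 * d) ^ S m * (2 * (b / d / r ^ m))).
{ apply Rmult_le_compat.
  - apply pow_le; unfold d in *; nra.
  - apply Rplus_le_le_0_compat; apply Cmod_ge_0.
  - apply pow_incr; unfold d in *; nra.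
  - lra. }
(* The powers of [d] cancel, one against the bound b / d and [m] against r^m. *)
right; unfold r, Rdiv; rewrite !Rpow_mult_distr, !pow_inv.
rewrite <- (tech_pow_Rmult d).
assert (dm := pow_nonzero d m ltac:(lra)); assert (cm := pow_nonzero c m ltac:(lra)).
assert (nm := pow_nonzero (INR (S m)) m ltac:(lra)).
field; repeat split; trivial; lra.
Qed.
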